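(* Let $L_{ii},U_{ii},L_{jj},U_{jj},L_{ij},U_{ij}$ be real numbers with $0\le L_{ii}\le U_{ii}$, $0\le L_{jj}\le U_{jj}$ and $L_{ij}\le U_{ij}$, and let $\mathcal{J}_C$, $\mathcal{J}_S$, $\mathcal{J}_V$ be the sets of $2\times 2$ Hermitian matrices defined from these bounds in the context. Then $$\operatorname{conv}(\mathcal{J}_C)=\mathcal{J}_S\cap\mathcal{J}_V ,$$ where $\operatorname{conv}$ denotes the convex hull.
   Context: A $2\times 2$ Hermitian matrix with rows and columns indexed by $i,j$ ($i\neq j$) is written $X=W+\sqrt{-1}\,T$ with $W,T$ real, so $W_{ij}=W_{ji}$, $T_{ij}=-T_{ji}$, $T_{ii}=T_{jj}=0$; it is thus determined by the four real numbers $W_{ii},W_{jj},W_{ij},T_{ij}$. $\mathcal{J}_C$ is the set of such matrices satisfying $L_{ii}\le W_{ii}\le U_{ii}$; $L_{jj}\le W_{jj}\le U_{jj}$; $L_{ij}W_{ij}\le T_{ij}\le U_{ij}W_{ij}$; $W_{ij}\ge 0$; and $W_{ii}W_{jj}=W_{ij}^2+T_{ij}^2$. $\mathcal{J}_S$ is the set of such matrices satisfying $L_{ii}\le W_{ii}\le U_{ii}$; $L_{jj}\le W_{jj}\le U_{jj}$; $L_{ij}W_{ij}\le T_{ij}\le U_{ij}W_{ij}$; $W_{ij}\ge 0$; and $W_{ii}W_{jj}\ge W_{ij}^2+T_{ij}^2$. Define $f:\mathbb{R}\to\mathbb{R}$ by $f(x)=(\sqrt{1+x^2}-1)/x$ for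 $x\ne 0$ and $f(0)=0$ (so $|f(x)|<1$ for all $x$). Define $$\pi_0=-\sqrt{L_{ii}L_{jj}U_{ii}U_{jj}},\qquad \pi_1=-\sqrt{L_{jj}U_{jj}},\qquad \pi_2=-\sqrt{L_{ii}U_{ii}},$$ $$\pi_3=(\sqrt{L_{ii}}+\sqrt{U_{ii}})(\sqrt{L_{jj}}+\sqrt{U_{jj}})\frac{1-f(L_{ij})f(U_{ij})}{1+f(L_{ij})f(U_{ij})},$$ $$\pi_4=(\sqrt{L_{ii}}+\sqrt{U_{ii}})(\sqrt{L_{jj}}+\sqrt{U_{jj}})\frac{f(L_{ij})+f(U_{ij})}{1+f(L_{ij})f(U_{ij})}.$$ $\mathcal{J}_V$ is the set of such matrices satisfying both linear inequalities $$\pi_0+\pi_1W_{ii}+\pi_2W_{jj}+\pi_3W_{ij}+\pi_4T_{ij}\ \ge\ U_{jj}W_{ii}+U_{ii}W_{jj}-U_{ii}U_{jj},$$ $$\pi_0+\pi_1W_{ii}+\pi_2W_{jj}+\pi_3W_{ij}+\pi_4T_{ij}\ \ge\ L_{jj}W_{ii}+L_{ii}W_{jj}-L_{ii}L_{jj}.$$ *)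

(* Defs.v *)
From mathcomp Require Import all_boot all_order all_algebra.
From mathcomp Require Import sesquilinear.
From mathcomp Require Import complex.
From mathcomp Require Import classical_sets reals convex.

Set Implicit Arguments.
Unset Strict Implicit.
Unset Printing Implicit Defensive.

Import Order.TTheory GRing.Theory Num.Theory.
Local Open Scope classical_set_scope.
Local Open Scope ring_scope.
Local Open Scope complex_scope.

(* The index i is (0 : 'I_2) and the index j is (1 : 'I_2), and
   X = reW X + sqrt(-1) imT X. *)
Definition reW (R : realType) (X : 'M[R[i]]_2) (k l : 'I_2) : R := complex.Re (X k l).
Definition imT (R : realType) (X : 'M[R[i]]_2) (k l : 'I_2) : R := complex.Im (X k l).

(* The scalars are R[i], but the weights of a convex combination are scalars t
   with 0 <= t <= 1 for the partial order of R[i], in which 0 <= t forces t to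
   be real: this is the usual (real) convex hull. *)
Definition convex_hull (R : realType) (A : set 'M[R[i]]_2) : set 'M[R[i]]_2 :=
  smallest (@convex_set R[i] 'M[R[i]]_2) A.

Definition bounded_herm (R : realType) (Lii Uii Ljj Ujj Lij Uij : R)
    (X : 'M[R[i]]_2) : Prop :=
  [/\ X \is hermsymmx,
      Lii <= reW X 0 0 <= Uii,
      Ljj <= reW X 1 1 <= Ujj,
      Lij * reW X 0 1 <= imT X 0 1 <= Uij * reW X 0 1 &
      0 <= reW X 0 1].

Definition J_C (R : realType) (Lii Uii Ljj Ujj Lij Uij : R) :
    set 'M[R[i]]_2 :=
  [set X | bounded_herm Lii Uii Ljj Ujj Lij Uij X /\
           reW X 0 0 * reW X 1 1 = reW X 0 1 ^+ 2 + imT X 0 1 ^+ 2].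

Definition J_S (R : realType) (Lii Uii Ljj Ujj Lij Uij : R) :
    set 'M[R[i]]_2 :=
  [set X | bounded_herm Lii Uii Ljj Ujj Lij Uij X /\
           reW X 0 0 * reW X 1 1 >= reW X 0 1 ^+ 2 + imT X 0 1 ^+ 2].

(* tan (theta / 2) as a function of x = tan theta, for |theta| < pi / 2. *)
Definition fhalf (R : realType) (x : R) : R :=
  if x == 0 then 0 else (Num.sqrt (1 + x ^+ 2) - 1) / x.

Definition pi0 (R : realType) (Lii Uii Ljj Ujj : R) : R :=
  - Num.sqrt (Lii * Ljj * Uii * Ujj).

Definition pi1 (R : realType) (Ljj Ujj : R) : R := - Num.sqrt (Ljj * Ujj).

Definition pi2 (R : realType) (Lii Uii : R) : R := - Num.sqrt (Lii * Uii).

Definition pi3 (R : realType) (Lii Uii Ljj Ujj Lij Uij : R) : R :=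
  (Num.sqrt Lii + Num.sqrt Uii) * (Num.sqrt Ljj + Num.sqrt Ujj) *
  ((1 - fhalf Lij * fhalf Uij) / (1 + fhalf Lij * fhalf Uij)).

Definition pi4 (R : realType) (Lii Uii Ljj Ujj Lij Uij : R) : R :=
  (Num.sqrt Lii + Num.sqrt Uii) * (Num.sqrt Ljj + Num.sqrt Ujj) *
  ((fhalf Lij + fhalf Uij) / (1 + fhalf Lij * fhalf Uij)).

Definition J_V (R : realType) (Lii Uii Ljj Ujj Lij Uij : R) :
    set 'M[R[i]]_2 :=
  [set X | let lhs := pi0 Lii Uii Ljj Ujj + pi1 Ljj Ujj * reW X 0 0
                      + pi2 Lii Uii * reW X 1 1
                      + pi3 Lii Uii Ljj Ujj Lij Uij * reW X 0 1
                      + pi4 Lii Uii Ljj Ujj Lij Uij * imT X 0 1 in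
           [/\ X \is hermsymmx,
               lhs >= Ujj * reW X 0 0 + Uii * reW X 1 1 - Uii * Ujj &
               lhs >= Ljj * reW X 0 0 + Lii * reW X 1 1 - Lii * Ljj]].

(* Main.v *)
(* Write a = W_ii, b = W_jj and z = (W_ij, T_ij), so that J_C is |z| = sqrt (a b)
   with (a, b) in a box and z in a planar cone. Up to a positive factor the cuts
   read g z >= m (a, b), where g is the linear form equal to the norm on the two
   boundary rays of the cone (so g >= |z| inside) and m is the convex envelope
   over the box of the concave function sqrt (a b); this makes the cuts valid.
   Conversely, fix (a, b) and R = sqrt (a b). On a boundary ray, every length
   between m (a, b) and R is reached by mixing R with corners of the box. If
   g z <= R, then z lies on a chord between two such ray points; if g z > R, it
   lies on the radius between the chord g = R and the circle of radius R. *)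

Require Import Defs.
From mathcomp Require Import all_boot all_order all_algebra.
From mathcomp Require Import sesquilinear complex.
From mathcomp Require Import classical_sets reals convex.
From mathcomp Require Import interval_inference ring lra.
Import Order.TTheory GRing.Theory Num.Theory.
Local Open Scope classical_set_scope.
Local Open Scope ring_scope.

(** * Real convex combinations *)

Lemma between_convex {R : realFieldType} (x y z : R) : x <= y <= z ->
  exists s, 0 <= s <= 1 /\ y = s * x + (1 - s) * z.
Proof.
move=> /andP[xy yz]; have [xz|zx] := ltP x z; last first.
  by exists 0; rewrite lexx ler01; split=> //; lra.
have zx0 : 0 < z - x by rewrite subr_gt0.
exists ((z - y) / (z - x)); split; last by field; rewrite gt_eqF.
by rewrite divr_ge0 ?subr_ge0 ?(ltW xz)//= ler_pdivrMr// mul1r lerB.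
Qed.

(** Convexity of a set of quadruples (W_ii, W_jj, W_ij, T_ij) under real weights. It lets the
    geometry be done over the reals; [P] is later a convex set of matrices read through [herm2]. *)
Definition convex4 {R : realFieldType} (P : R -> R -> R -> R -> Prop) :=
  forall s a b w t a' b' w' t', 0 <= s <= 1 -> P a b w t -> P a' b' w' t' ->
  P (s * a + (1 - s) * a') (s * b + (1 - s) * b')
    (s * w + (1 - s) * w') (s * t + (1 - s) * t').

Lemma convex4_comb3 {R : realFieldType} (P : R -> R -> R -> R -> Prop)
    (x y z a0 b0 w0 t0 a1 b1 w1 t1 a2 b2 w2 t2 : R) : convex4 P ->
  0 <= x -> 0 <= y -> 0 <= z -> x + y + z = 1 ->
  P a0 b0 w0 t0 -> P a1 b1 w1 t1 -> P a2 b2 w2 t2 ->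
  P (x * a0 + y * a1 + z * a2) (x * b0 + y * b1 + z * b2)
    (x * w0 + y * w1 + z * w2) (x * t0 + y * t1 + z * t2).
Proof.
move=> cP x0 y0 z0 xyz P0 P1 P2; have [yz0|yz0] := eqVneq (y + z) 0.
  have [-> ->] : y = 0 /\ z = 0 by split; lra.
  have -> : x = 1 by lra.
  by rewrite !mul1r !mul0r !addr0.
have yz : 0 < y + z by rewrite lt_neqAle eq_sym yz0 addr_ge0.
have s01 : 0 <= y / (y + z) <= 1.
  by rewrite divr_ge0 ?(ltW yz)//= ler_pdivrMr// mul1r lerDl.
have x01 : 0 <= x <= 1 by lra.
have := cP _ _ _ _ _ _ _ _ _ x01 P0 (cP _ _ _ _ _ _ _ _ _ s01 P1 P2).
have E u v : (1 - x) * (y / (y + z) * u + (1 - y / (y + z)) * v) =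
    y * u + z * v.
  by have -> : x = 1 - (y + z); [lra|field].
by rewrite !E !addrA.
Qed.

(** * The cuts and the lower envelope of sqrt (a b) on the box *)

(* The two inequalities of J_V, with L_ii = al^2, U_ii = be^2, L_jj = ga^2,
   U_jj = de^2 and g = (pi_3 W_ij + pi_4 T_ij) / ((al + be) (ga + de)). *)
Definition cuts {R : realFieldType} (al be ga de a b g : R) :=
  - (al * ga * be * de) - ga * de * a - al * be * b
    + (al + be) * (ga + de) * g >= de ^+ 2 * a + be ^+ 2 * b - be ^+ 2 * de ^+ 2
  /\
  - (al * ga * be * de) - ga * de * a - al * be * b
    + (al + be) * (ga + de) * g >= ga ^+ 2 * a + al ^+ 2 * b - al ^+ 2 * ga ^+ 2.

(** Let c = (al + be)(ga + de). At g = r s the slack of the first cut is c (be - r)(de - s) + de (ga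
    + de)(r - al)(be - r) + be (al + be)(s - ga)(de - s), and that of the second is c (r - al)(s -
    ga) + ga (ga + de)(r - al)(be - r) + al (al + be)(s - ga)(de - s). Both slacks are nondecreasing
    in g. *)
Lemma cuts_mul {R : realFieldType} (al be ga de r s g : R) :
  0 <= al -> 0 <= ga -> al <= r <= be -> ga <= s <= de -> r * s <= g ->
  cuts al be ga de (r ^+ 2) (s ^+ 2) g.
Proof.
move=> al0 ga0 /andP[alr rbe] /andP[gas sde] rsg.
have [r1 r2 s1 s2] : [/\ 0 <= r - al, 0 <= be - r, 0 <= s - ga & 0 <= de - s].
  by rewrite !subr_ge0.
have be0 : 0 <= be by lra.
have de0 : 0 <= de by lra.
have c0 : 0 <= (al + be) * (ga + de) by rewrite mulr_ge0 ?addr_ge0.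
have h0 := mulr_ge0 c0 (mulr_ge0 r1 s1).
have h1 := mulr_ge0 c0 (mulr_ge0 r2 s2).
have [ru sv] := (mulr_ge0 r1 r2, mulr_ge0 s1 s2).
have gd0 : 0 <= ga + de by rewrite addr_ge0.
have ab0 : 0 <= al + be by rewrite addr_ge0.
have h2 := mulr_ge0 (mulr_ge0 ga0 gd0) ru.
have h3 := mulr_ge0 (mulr_ge0 al0 ab0) sv.
have h4 := mulr_ge0 (mulr_ge0 de0 gd0) ru.
have h5 := mulr_ge0 (mulr_ge0 be0 ab0) sv.
have h6 : 0 <= (al + be) * (ga + de) * (g - r * s).
  by rewrite mulr_ge0 ?subr_ge0.
by split; lra.
Qed.

Lemma sqrt_between {R : rcfType} (x y a : R) : 0 <= x -> 0 <= y ->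
  x ^+ 2 <= a <= y ^+ 2 -> x <= Num.sqrt a <= y.
Proof.
move=> x0 y0 /andP[xa ay]; rewrite -{1}[x]ger0_norm// -[y]ger0_norm//.
by rewrite -!sqrtr_sqr !ler_wsqrtr.
Qed.

(* The lower envelope of sqrt (a b) on the box is the maximum of two affine
   functions, each interpolating the value r s at three corners
   (r ^+ 2, s ^+ 2); the graph of sqrt (a b) is the upper envelope. *)
Lemma convex4_ray {R : rcfType} (P : R -> R -> R -> R -> Prop)
    (al be ga de e1 e2 a b g : R) : convex4 P ->
  (forall r s, al <= r <= be -> ga <= s <= de ->
     P (r ^+ 2) (s ^+ 2) (r * s * e1) (r * s * e2)) ->
  0 <= al <= be -> 0 <= ga <= de -> 0 < (al + be) * (ga + de) ->
  al ^+ 2 <= a <= be ^+ 2 -> ga ^+ 2 <= b <= de ^+ 2 ->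
  0 <= g -> g ^+ 2 <= a * b -> cuts al be ga de a b g ->
  P a b (g * e1) (g * e2).
Proof.
move=> cP Ph /andP[al0 albe] /andP[ga0 gade] c0 aP bP g0 gab [cut1 cut2].
(* A length m below g is enough: with a and b fixed, g is a mixture of m and the length sqrt (a b),
   which [Ph] provides. *)
suff [m [mg Pm]] : exists m, m <= g /\ P a b (m * e1) (m * e2).
  have [a0 b0] : 0 <= a /\ 0 <= b.
    by split; [case/andP: aP|case/andP: bP] => + _; apply: le_trans;
      rewrite sqr_ge0.
  have hab : g <= Num.sqrt a * Num.sqrt b.
    rewrite -sqrtrM// -[g]ger0_norm// -sqrtr_sqr ler_sqrt//.
    by rewrite mulr_ge0.
  have be0 := le_trans al0 albe; have de0 := le_trans ga0 gade.
  have ar : al <= Num.sqrt a <= be by apply: sqrt_between.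
  have bs : ga <= Num.sqrt b <= de by apply: sqrt_between.
  have PM := Ph _ _ ar bs; rewrite !sqr_sqrtr// in PM.
  have [|s [s01 ->]] := @between_convex _ m g (Num.sqrt a * Num.sqrt b).
    by rewrite mg.
  have := cP _ _ _ _ _ _ _ _ _ s01 Pm PM.
  by rewrite -!mulrDl !mulrA -!mulrDl !(addrC s) !subrK !mul1r.
have [x [/andP[x0 x1] ax]] := between_convex _ _ _ aP.
have [y [/andP[y0 y1] by_]] := between_convex _ _ _ bP.
have al1 : al <= al <= be by rewrite lexx.
have be1 : al <= be <= be by rewrite lexx andbT.
have ga1 : ga <= ga <= de by rewrite lexx.
have de1 : ga <= de <= de by rewrite lexx andbT.
have P00 := Ph _ _ al1 ga1; have P01 := Ph _ _ al1 de1.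
have P10 := Ph _ _ be1 ga1; have P11 := Ph _ _ be1 de1.
(* The diagonal x + y = 1 joins the corners (al, de) and (be, ga) and splits the box into two
   triangles. The witness is the barycentric interpolation of r s in the triangle containing (a, b);
   the matching cut bounds it by g. *)
have [xy|xy] := leP 1 (x + y).
- exists ((x + y - 1) * (al * ga) + (1 - x) * (be * ga) + (1 - y) * (al * de)).
  split.
    rewrite -(ler_pM2l c0); move: cut2; rewrite ax by_; lra.
  have w0 : 0 <= x + y - 1 by lra.
  have w1 : 0 <= 1 - x by lra.
  have w2 : 0 <= 1 - y by lra.
  have w3 : x + y - 1 + (1 - x) + (1 - y) = 1 by ring.
  have := convex4_comb3 _ _ _ _ _ _ _ _ _ _ _ _ _ _ _ _ cP w0 w1 w2 w3 P00 P10 P01.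
  by rewrite ax by_; congr P; ring.
- exists ((1 - x - y) * (be * de) + x * (al * de) + y * (be * ga)).
  split.
    rewrite -(ler_pM2l c0); move: cut1; rewrite ax by_; lra.
  have w0 : 0 <= 1 - x - y by lra.
  have w3 : 1 - x - y + x + y = 1 by ring.
  have := convex4_comb3 _ _ _ _ _ _ _ _ _ _ _ _ _ _ _ _ cP w0 x0 y0 w3 P11 P01 P10.
  by rewrite ax by_; congr P; ring.
Qed.

(** * The linear form attached to the cone *)

Lemma sqrt_sqr_add1_gt0 {R : rcfType} (x : R) : 0 < Num.sqrt (1 + x ^+ 2).
Proof. by rewrite sqrtr_gt0 ltr_wpDr ?sqr_ge0. Qed.

(** Double-angle formulas: they recover tan th and 1 / cos th rationally from tan (th / 2), so that
    later identities need only [field]. *)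
Lemma fhalfP {R : realType} (x : R) : [/\ fhalf x ^+ 2 < 1,
  x = 2 * fhalf x / (1 - fhalf x ^+ 2) &
  Num.sqrt (1 + x ^+ 2) = (1 + fhalf x ^+ 2) / (1 - fhalf x ^+ 2)].
Proof.
rewrite /fhalf; case: eqVneq => [->|x0].
  by rewrite expr0n /= !(addr0, subr0, mulr0, mul0r) sqrtr1 divr1 ltr01.
have S0 := sqrt_sqr_add1_gt0 x; have : Num.sqrt (1 + x ^+ 2) ^+ 2 = 1 + x ^+ 2.
  by rewrite sqr_sqrtr// addr_ge0 ?sqr_ge0.
move: (Num.sqrt _) S0 => S S0 SE.
have xE : x ^+ 2 = (S - 1) * (S + 1) by rewrite -subr_sqr SE; ring.
have S1 : S + 1 != 0 by rewrite gt_eqF// ltr_wpDr.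
have Sm : S - 1 != 0.
  by apply: contra_neq x0 => Sm; apply/eqP; rewrite -sqrf_eq0 xE Sm mul0r.
have fE : ((S - 1) / x) ^+ 2 = (S - 1) / (S + 1).
  by rewrite expr_div_n xE; field; rewrite Sm S1.
rewrite fE; split.
- by rewrite ltr_pdivrMr ?ltr_wpDr// mul1r; lra.
- by rewrite -[LHS](mulfK x0) -expr2 xE; field; rewrite x0 S1/=; lra.
- by field; rewrite S1/=; lra.
Qed.

(* fhalf (tan th) = tan (th / 2) gives (p, q) = (cos m, sin m) / cos h for the
   angle m of the bisector of the cone and its half opening h, so p w + q t is
   the norm on both boundary rays. *)
Lemma cone_functional {R : realType} (L U : R) :
  let p := (1 - fhalf L * fhalf U) / (1 + fhalf L * fhalf U) in
  let q := (fhalf L + fhalf U) / (1 + fhalf L * fhalf U) in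
  [/\ p + q * L = Num.sqrt (1 + L ^+ 2), p + q * U = Num.sqrt (1 + U ^+ 2) &
   forall w t, 0 <= w -> L * w <= t <= U * w ->
     Num.sqrt (w ^+ 2 + t ^+ 2) <= p * w + q * t].
Proof.
have [f1 LE kL] := fhalfP L; have [g1 UE kU] := fhalfP U.
have := sqrt_sqr_add1_gt0 L; have := sqrt_sqr_add1_gt0 U.
rewrite kL kU; move: (fhalf L) (fhalf U) f1 g1 LE UE {kL kU}.
move=> f g f1 g1 -> -> /= kU0 kL0.
have fg : 0 < 1 + f * g by have := sqr_ge0 (f + g); lra.
have [fg0 f0 g0] : [/\ 1 + f * g != 0, 1 - f ^+ 2 != 0 & 1 - g ^+ 2 != 0].
  by split; lra.
set p := _ / _; set q := _ / _.
have pqL : p + q * (2 * f / (1 - f ^+ 2)) = (1 + f ^+ 2) / (1 - f ^+ 2).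
  by rewrite /p /q; field; rewrite fg0 f0.
have pqU : p + q * (2 * g / (1 - g ^+ 2)) = (1 + g ^+ 2) / (1 - g ^+ 2).
  by rewrite /p /q; field; rewrite fg0 g0.
split=> // w t w0 tP.
have q1 : 0 <= 1 - q ^+ 2.
  have -> : 1 - q ^+ 2 = (1 - f ^+ 2) * (1 - g ^+ 2) / (1 + f * g) ^+ 2.
    by rewrite /q; field.
  by rewrite divr_ge0 ?sqr_ge0// mulr_ge0// subr_ge0 ltW.
have g_ge0 : 0 <= p * w + q * t.
  have [s [/andP[s0 s1] ->]] := between_convex _ _ _ tP.
  set l := 2 * f / _ in pqL *; set u := 2 * g / _ in pqU *.
  have -> : p * w + q * (s * (l * w) + (1 - s) * (u * w)) =
      (s * (p + q * l) + (1 - s) * (p + q * u)) * w by ring.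
  rewrite mulr_ge0// pqL pqU addr_ge0// mulr_ge0 ?subr_ge0//; exact: ltW.
rewrite -[leRHS]ger0_norm// -sqrtr_sqr ler_wsqrtr//.
(* The quadratic form g^2 - |z|^2 vanishes on both boundary rays, so it is a multiple of (t - L w)(U
   w - t); comparing coefficients of t^2 gives the factor 1 - q^2. *)
have -> : (p * w + q * t) ^+ 2 = w ^+ 2 + t ^+ 2 + (1 - q ^+ 2) *
    ((t - 2 * f / (1 - f ^+ 2) * w) * (2 * g / (1 - g ^+ 2) * w - t)).
  by rewrite /p /q; field; rewrite fg0 f0 g0.
by case/andP: tP => ? ?; rewrite lerDl !mulr_ge0// subr_ge0.
Qed.

(** * Points of the cone as mixtures of points with |z|^2 = a b *)

Section Hull.
Context {R : realType}.
Variables (P : R -> R -> R -> R -> Prop) (L U p q kL kU al be ga de : R).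
Hypotheses (cP : convex4 P) (kL0 : 0 < kL) (kU0 : 0 < kU).
Hypotheses (kLE : kL ^+ 2 = 1 + L ^+ 2) (kUE : kU ^+ 2 = 1 + U ^+ 2).
Hypotheses (LU : L <= U) (pqL : p + q * L = kL) (pqU : p + q * U = kU).
Hypothesis norm_le : forall w t, 0 <= w -> L * w <= t <= U * w ->
  Num.sqrt (w ^+ 2 + t ^+ 2) <= p * w + q * t.
Hypotheses (al0 : 0 <= al) (albe : al <= be) (ga0 : 0 <= ga) (gade : ga <= de).
Hypothesis P_cone : forall a b w t,
  al ^+ 2 <= a <= be ^+ 2 -> ga ^+ 2 <= b <= de ^+ 2 ->
  L * w <= t <= U * w -> 0 <= w -> a * b = w ^+ 2 + t ^+ 2 -> P a b w t.

(** The level line of g through z meets the boundary rays at two points that [convex4_ray] puts in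
    [P], and z lies between them. *)
Lemma convex4_cone_small a b w t :
  al ^+ 2 <= a <= be ^+ 2 -> ga ^+ 2 <= b <= de ^+ 2 ->
  L * w <= t <= U * w -> 0 <= w -> (p * w + q * t) ^+ 2 <= a * b ->
  0 < (al + be) * (ga + de) -> cuts al be ga de a b (p * w + q * t) ->
  P a b w t.
Proof.
move=> aP bP tP w0 gab c0 hcut.
have be0 := le_trans al0 albe; have de0 := le_trans ga0 gade.
have g0 : 0 <= p * w + q * t by apply: le_trans (norm_le _ _ w0 tP).
have ray m k : 0 < k -> k ^+ 2 = 1 + m ^+ 2 -> L <= m <= U ->
    P a b ((p * w + q * t) * k^-1) ((p * w + q * t) * (m / k)).
  move=> k0 kE /andP[Lm mU]; have kn : k != 0 by rewrite gt_eqF.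
  apply: (convex4_ray P al be ga de) => //; rewrite ?al0 ?ga0//.
  move=> r s /andP[alr rbe] /andP[gas sde].
  have [r0 s0] := (le_trans al0 alr, le_trans ga0 gas).
  have rsk : 0 <= r * s * k^-1 by rewrite !mulr_ge0// invr_ge0 ltW.
  apply: P_cone => //.
  - by rewrite !ler_sqr ?nnegrE// alr.
  - by rewrite !ler_sqr ?nnegrE// gas.
  - by rewrite [r * s * (m / k)]mulrCA !ler_wpM2r.
  - transitivity ((r * s) ^+ 2 * ((1 + m ^+ 2) / k ^+ 2)); last by field.
    by rewrite -kE divff ?expf_neq0// mulr1 exprMn.
(* Here |z| <= g z = 0 forces z = 0, the point of length 0 on either ray. *)
have [g00|gn0] := eqVneq (p * w + q * t) 0.
  have := norm_le _ _ w0 tP; rewrite g00 => /le_trans/(_ (lexx _)).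
  rewrite -sqrtr0 ler_sqrt// => wt.
  have := ray L kL kL0 kLE; rewrite lexx LU g00 !mul0r => /(_ isT).
  have := sqr_ge0 w; have := sqr_ge0 t => t2 w2.
  have /eqP -> : w == 0 by rewrite -sqrf_eq0; apply/eqP; lra.
  by have /eqP -> : t == 0 by rewrite -sqrf_eq0; apply/eqP; lra.
have gp : 0 < p * w + q * t by rewrite lt_neqAle eq_sym gn0.
have PL := ray L kL kL0 kLE; have PU := ray U kU kU0 kUE.
rewrite lexx LU in PL; rewrite lexx LU in PU.
have [s [/andP[s0 s1] tE]] := between_convex _ _ _ tP.
have gE : p * w + q * t = (s * kL + (1 - s) * kU) * w.
  by rewrite tE -pqL -pqU; ring.
have kLn : kL != 0 by rewrite gt_eqF.
have kUn : kU != 0 by rewrite gt_eqF.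
have kwn : (s * kL + (1 - s) * kU) * w != 0 by rewrite -gE.
(* z is the mixture of (w, L w) and (w, U w) with weight s, where g takes the values kL w and kU w.
   Rescaling both points to the level g z turns s into s kL w / g z. *)
have z01 : 0 <= s * kL * w / (p * w + q * t) <= 1.
  rewrite divr_ge0 ?(ltW gp) ?mulr_ge0// ?(ltW kL0)//= ler_pdivrMr// mul1r gE.
  by rewrite mulrDl lerDl !mulr_ge0// ?subr_ge0// ltW.
have := cP _ _ _ _ _ _ _ _ _ z01 (PL isT) (PU isT).
rewrite -!mulrDl !(addrC (_ / _)) !subrK !mul1r gE; congr P.
  by field; move: kwn; rewrite mulf_eq0 negb_or => /andP[-> ->]; rewrite kLn kUn.
rewrite [in RHS]tE.
by field; move: kwn; rewrite mulf_eq0 negb_or => /andP[-> ->]; rewrite kLn kUn.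
Qed.

(* A point z outside the triangle cut out of the cone by the chord g = R, where
   R = sqrt (a b), lies on the radius between that chord and the circle of
   radius R. *)
Lemma convex4_cone a b w t :
  al ^+ 2 <= a <= be ^+ 2 -> ga ^+ 2 <= b <= de ^+ 2 ->
  L * w <= t <= U * w -> 0 <= w -> w ^+ 2 + t ^+ 2 <= a * b ->
  cuts al be ga de a b (p * w + q * t) -> P a b w t.
Proof.
move=> aP bP tP w0 wtab hcut.
have be0 := le_trans al0 albe; have de0 := le_trans ga0 gade.
have [a0 b0] : 0 <= a /\ 0 <= b.
  by split; [case/andP: aP|case/andP: bP] => + _; apply: le_trans;
    rewrite sqr_ge0.
have [w2 t2] := (sqr_ge0 w, sqr_ge0 t).
(* If a b = 0, the bound on |z|^2 is already an equality and [P_cone] applies. *)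
have [ab0|abn0] := eqVneq (a * b) 0.
  by apply: P_cone => //; apply/eqP; rewrite eq_le wtab ab0 addr_ge0.
have ab_gt0 : 0 < a * b by rewrite lt_neqAle eq_sym abn0 mulr_ge0.
have c0 : 0 < (al + be) * (ga + de).
  have be_gt0 : 0 < be.
    rewrite lt_neqAle be0 eq_sym andbT; apply: contra_neq abn0 => be00.
    by case/andP: aP => _; rewrite be00 expr0n/= => aP; have -> : a = 0; lra.
  have de_gt0 : 0 < de.
    rewrite lt_neqAle de0 eq_sym andbT; apply: contra_neq abn0 => de00.
    by case/andP: bP => _; rewrite de00 expr0n/= => bP; have -> : b = 0; lra.
  by rewrite mulr_gt0 ?ltr_wpDl.
have [small|big] := leP ((p * w + q * t) ^+ 2) (a * b).
  exact: convex4_cone_small.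
have ng := norm_le _ _ w0 tP.
have g0 : 0 <= p * w + q * t by apply: le_trans ng.
have g_gt0 : 0 < p * w + q * t.
  by rewrite lt_neqAle g0 eq_sym andbT; apply: contraTneq big => ->;
    rewrite expr0n/= -leNgt ltW.
have n_gt0 : 0 < w ^+ 2 + t ^+ 2.
  rewrite lt_neqAle eq_sym addr_ge0// andbT; apply: contraTneq g_gt0 => wt.
  have /eqP -> : w == 0 by rewrite -sqrf_eq0; apply/eqP; lra.
  have /eqP -> : t == 0 by rewrite -sqrf_eq0; apply/eqP; lra.
  by rewrite !mulr0 addr0 ltxx.
have rgt0 : 0 < Num.sqrt (a * b) by rewrite sqrtr_gt0.
have rE : Num.sqrt (a * b) ^+ 2 = a * b by rewrite sqr_sqrtr// ltW.
have ngt0 : 0 < Num.sqrt (w ^+ 2 + t ^+ 2) by rewrite sqrtr_gt0.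
have nE : Num.sqrt (w ^+ 2 + t ^+ 2) ^+ 2 = w ^+ 2 + t ^+ 2.
  by rewrite sqr_sqrtr// ltW.
have nr : Num.sqrt (w ^+ 2 + t ^+ 2) <= Num.sqrt (a * b) by rewrite ler_wsqrtr.
have rg : Num.sqrt (a * b) <= p * w + q * t.
  by rewrite -ler_sqr ?nnegrE// ?(ltW rgt0)// rE ltW.
move: (Num.sqrt (a * b)) (Num.sqrt (w ^+ 2 + t ^+ 2)) rgt0 rE ngt0 nE nr rg.
move=> r n r_gt0 rE ngt0 nE nr rg.
have scale k : 0 <= k -> L * (k * w) <= k * t <= U * (k * w).
  by move: tP => /andP[Lt tU] k0; rewrite !(mulrCA _ k) !ler_wpM2l.
have k0 : 0 <= r / (p * w + q * t) by rewrite divr_ge0// ltW.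
have k1 : 0 <= r / n by rewrite divr_ge0// ltW.
have gn0 : p * w + q * t != 0 by rewrite gt_eqF.
have nn0 : n != 0 by rewrite gt_eqF.
have gk : p * (r / (p * w + q * t) * w) + q * (r / (p * w + q * t) * t) = r.
  by field.
have P0 : P a b (r / (p * w + q * t) * w) (r / (p * w + q * t) * t).
  apply: convex4_cone_small; rewrite ?gk ?rE ?(mulr_ge0 k0 w0) ?scale//.
  (* At the level g = r = sqrt (a b) the cuts follow from [cuts_mul], without using [hcut]. *)
  have ar := sqrt_between _ _ _ al0 be0 aP; have bs := sqrt_between _ _ _ ga0 de0 bP.
  have := cuts_mul al be ga de _ _ r al0 ga0 ar bs.
  rewrite !sqr_sqrtr//; apply.
  by rewrite -ler_sqr ?nnegrE ?mulr_ge0 ?sqrtr_ge0 ?(ltW r_gt0)// exprMn rE !sqr_sqrtr.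
have P1 : P a b (r / n * w) (r / n * t).
  apply: P_cone; rewrite ?(mulr_ge0 k1 w0) ?scale//.
  by rewrite !exprMn -mulrDr exprVn -rE -nE; field.
have kk : r / (p * w + q * t) <= 1 <= r / n.
  by rewrite ler_pdivrMr// mul1r rg ler_pdivlMr// mul1r.
have [s [s01 sE]] := between_convex _ _ _ kk.
have := cP _ _ _ _ _ _ _ _ _ s01 P0 P1.
have mix x : s * (r / (p * w + q * t) * x) + (1 - s) * (r / n * x) = x.
  by rewrite 2!(mulrA _ (_ / _)) -mulrDl -sE mul1r.
by rewrite !mix -!mulrDl addrC subrK !mul1r.
Qed.

End Hull.

(** * Hermitian matrices in real coordinates *)

Local Open Scope complex_scope.
Local Open Scope convex_scope.

Lemma ord2P (k : 'I_2) : k = 0 \/ k = 1.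
Proof. by case: k => [[|[|//]] h]; [left|right]; apply/val_inj. Qed.

Lemma hermsymmxP {R : realType} (X : 'M[R[i]]_2) :
  X \is hermsymmx <->
  [/\ imT X 0 0 = 0, imT X 1 1 = 0, reW X 1 0 = reW X 0 1 &
      imT X 1 0 = - imT X 0 1].
Proof.
rewrite /imT /reW; split=> [/is_hermitianmxP XE|[h0 h1 h2 h3]].
  have XkE k l : X k l = (X l k)^*.
    by rewrite {1}XE expr0 scale1r !mxE; case: (X l k).
  move: (XkE 0 0) (XkE 1 1) (XkE 1 0).
  case: (X 0 0) (X 1 1) (X 1 0) (X 0 1) => [a a'] [b b'] [c c'] [d d'] /=.
  by move=> [a0] [b0] [-> ->]; split=> //; lra.
apply/is_hermitianmxP/matrixP => k l; rewrite expr0 scale1r !mxE.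
move: h0 h1 h2 h3.
have [-> | ->] := ord2P k; have [-> | ->] := ord2P l;
case: (X 0 0) (X 1 1) (X 1 0) (X 0 1) => [a a'] [b b'] [c c'] [d d'] /=;
by move=> h0 h1 h2 h3; apply/eqP; rewrite eq_complex/= ?h0 ?h1 ?h2 ?h3 ?oppr0 ?opprK !eqxx.
Qed.

Definition herm2 {R : realType} (a b w t : R) : 'M[R[i]]_2 :=
  \matrix_(k, l) if k == l then (if k == 0 then a else b)%:C
                 else w +i* (if k == 0 then t else - t).

Lemma herm2_hermsymmx {R : realType} (a b w t : R) : herm2 a b w t \is hermsymmx.
Proof. by apply/hermsymmxP; rewrite /imT /reW !mxE. Qed.

Lemma herm2_coord {R : realType} (a b w t : R) :
  [/\ reW (herm2 a b w t) 0 0 = a, reW (herm2 a b w t) 1 1 = b,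
      reW (herm2 a b w t) 0 1 = w & imT (herm2 a b w t) 0 1 = t].
Proof. by rewrite /imT /reW !mxE. Qed.

Lemma hermsymmx_herm2 {R : realType} (X : 'M[R[i]]_2) : X \is hermsymmx ->
  X = herm2 (reW X 0 0) (reW X 1 1) (reW X 0 1) (imT X 0 1).
Proof.
move=> /hermsymmxP; rewrite /imT /reW => -[h0 h1 h2 h3].
apply/matrixP => k l; apply/eqP; rewrite eq_complex; move: h0 h1 h2 h3.
by have [-> | ->] := ord2P k; have [-> | ->] := ord2P l;
  rewrite mxE/= => h0 h1 h2 h3; rewrite ?h0 ?h1 ?h2 ?h3 !eqxx.
Qed.

Section ConvCoord.
Context {R : realType}.
Implicit Types (X Y : convex_lmodType 'M[R[i]]_2) (l : {i01 R[i]}).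

Lemma i01_complex l : exists s : R, 0 <= s <= 1 /\ l%:num = s%:C.
Proof.
have : 0 <= l%:num by []. have : l%:num <= 1 by [].
case: (l%:num) => s s'; rewrite !lecE/= => /andP[_ s1] /andP[/eqP -> s0].
by exists s; rewrite s0 s1.
Qed.

Lemma reW_conv X Y l (s : R) k m : l%:num = s%:C ->
  reW (X <| l |> Y) k m = s * reW X k m + (1 - s) * reW Y k m.
Proof.
move=> lE; rewrite /reW !mxE /unstable.onem lE.
by case: (X k m) (Y k m) => [a a'] [b b'] /=; ring.
Qed.

Lemma imT_conv X Y l (s : R) k m : l%:num = s%:C ->
  imT (X <| l |> Y) k m = s * imT X k m + (1 - s) * imT Y k m.
Proof.
move=> lE; rewrite /imT !mxE /unstable.onem lE.
by case: (X k m) (Y k m) => [a a'] [b b'] /=; ring.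
Qed.

Lemma hermsymmx_conv X Y l :
  (X : 'M_2) \is hermsymmx -> (Y : 'M_2) \is hermsymmx ->
  (X <| l |> Y : 'M_2) \is hermsymmx.
Proof.
have [s [_ lE]] := i01_complex l.
move=> /hermsymmxP[x0 x1 x2 x3] /hermsymmxP[y0 y1 y2 y3].
apply/hermsymmxP; rewrite !(reW_conv _ _ _ _ _ _ lE) !(imT_conv _ _ _ _ _ _ lE).
by rewrite x0 x1 x2 x3 y0 y1 y2 y3; split=> //; ring.
Qed.

Lemma convex4_herm2 (A : set 'M[R[i]]_2) : convex_set A ->
  convex4 (fun a b w t => A (herm2 a b w t)).
Proof.
move=> cA s a b w t a' b' w' t' /andP[s0 s1] Ax Ay.
have c0 : 0 <= s%:C by rewrite ler0c.
have c1 : s%:C <= 1 by rewrite -[1]/(1%:C) lecR.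
have lE : (Itv01 c0 c1)%:num = s%:C by [].
have := cA (herm2 a b w t) (herm2 a' b' w' t') (Itv01 c0 c1).
rewrite !inE => /(_ Ax Ay).
rewrite [_ <| _ |> _]hermsymmx_herm2; last first.
  by apply: hermsymmx_conv; apply: herm2_hermsymmx.
rewrite !(reW_conv _ _ _ _ _ _ lE) (imT_conv _ _ _ _ _ _ lE).
by have [-> -> -> ->] := herm2_coord a b w t;
   have [-> -> -> ->] := herm2_coord a' b' w' t'.
Qed.

End ConvCoord.

(** * Convexity of the two sets and the hull *)

Lemma hyperbolic_convex {R : realFieldType} (s a b w t a' b' w' t' : R) :
  0 <= s <= 1 -> 0 <= a -> 0 <= b -> 0 <= a' -> 0 <= b' ->
  w ^+ 2 + t ^+ 2 <= a * b -> w' ^+ 2 + t' ^+ 2 <= a' * b' ->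
  (s * w + (1 - s) * w') ^+ 2 + (s * t + (1 - s) * t') ^+ 2 <=
  (s * a + (1 - s) * a') * (s * b + (1 - s) * b').
Proof.
move=> /andP[s0 s1] a0 b0 a'0 b'0 h h'; have s'0 : 0 <= 1 - s by lra.
(* Cauchy-Schwarz, then AM-GM: 4 (a b') (a' b) <= (a b' + a' b)^2 *)
have cs : 2 * (w * w' + t * t') <= a * b' + a' * b.
  apply: le_trans (ler_norm _) _.
  have v0 : 0 <= a * b' + a' * b by rewrite addr_ge0 ?mulr_ge0.
  rewrite -[leRHS]ger0_norm// -ler_sqr ?nnegrE// !real_normK ?num_real//.
  have := ler_pM (addr_ge0 (sqr_ge0 w) (sqr_ge0 t))
    (addr_ge0 (sqr_ge0 w') (sqr_ge0 t')) h h'.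
  have := sqr_ge0 (w * t' - w' * t); have := sqr_ge0 (a * b' - a' * b).
  by lra.
(* Expand the difference of the two sides in s^2, (1 - s)^2 and s (1 - s): the square terms are [h]
   and [h'], the cross term is [cs]. *)
have h0 := mulr_ge0 (mulr_ge0 s0 s0) (_ : 0 <= a * b - (w ^+ 2 + t ^+ 2)).
have h1 := mulr_ge0 (mulr_ge0 s'0 s'0) (_ : 0 <= a' * b' - (w' ^+ 2 + t' ^+ 2)).
have h2 := mulr_ge0 (mulr_ge0 s0 s'0)
  (_ : 0 <= a * b' + a' * b - 2 * (w * w' + t * t')).
move: h0 h1 h2; rewrite !subr_ge0 => /(_ h) h0 /(_ h') h1 /(_ cs) h2; lra.
Qed.

Lemma convex_between {R : realFieldType} (l u s x y : R) : 0 <= s <= 1 ->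
  l <= x <= u -> l <= y <= u -> l <= s * x + (1 - s) * y <= u.
Proof.
move=> /andP[s0 s1] /andP[lx xu] /andP[ly yu]; have s'0 : 0 <= 1 - s by lra.
have := ler_wpM2l s0 lx; have := ler_wpM2l s0 xu.
by have := ler_wpM2l s'0 ly; have := ler_wpM2l s'0 yu; lra.
Qed.

Section JSets.
Context {R : realType}.
Variables (al be ga de L U : R).
Hypotheses (al0 : 0 <= al) (albe : al <= be) (ga0 : 0 <= ga) (gade : ga <= de).
Hypothesis LU : L <= U.
Implicit Type X : 'M[R[i]]_2.

Let p := (1 - fhalf L * fhalf U) / (1 + fhalf L * fhalf U).
Let q := (fhalf L + fhalf U) / (1 + fhalf L * fhalf U).

Let JC := J_C (al ^+ 2) (be ^+ 2) (ga ^+ 2) (de ^+ 2) L U.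
Let JS := J_S (al ^+ 2) (be ^+ 2) (ga ^+ 2) (de ^+ 2) L U.
Let JV := J_V (al ^+ 2) (be ^+ 2) (ga ^+ 2) (de ^+ 2) L U.

Let be0 : 0 <= be. Proof. exact: le_trans albe. Qed.
Let de0 : 0 <= de. Proof. exact: le_trans gade. Qed.

(** Since the bounds are squares of nonnegative numbers, every square root in pi_0, ..., pi_4
    becomes a product of [al], [be], [ga], [de]. *)
Lemma J_V_cuts X : JV X <-> X \is hermsymmx /\
  cuts al be ga de (reW X 0 0) (reW X 1 1) (p * reW X 0 1 + q * imT X 0 1).
Proof.
rewrite /JV /J_V /= /cuts /pi0 /pi1 /pi2 /pi3 /pi4 -/p -/q.
rewrite -!exprMn !sqrtr_sqr !ger0_norm ?mulr_ge0//.
rewrite [_ * (p * _ + _)]mulrDr !mulrA !mulNr !addrA.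
by split=> [[? ? ?]|[? [? ?]]]; split.
Qed.

Lemma convex_J_S : convex_set JS.
Proof.
move=> X Y l; rewrite !inE => -[[hX Xa Xb Xt Xw] Xp] [[hY Ya Yb Yt Yw] Yp].
have [s [s01 lE]] := i01_complex l; have /andP[s0 s1] := s01.
have s'0 : 0 <= 1 - s by rewrite subr_ge0.
split; first split; rewrite ?(reW_conv _ _ _ _ _ _ lE) ?(imT_conv _ _ _ _ _ _ lE).
- exact: hermsymmx_conv.
- exact: convex_between.
- exact: convex_between.
- move: Xt Yt => /andP[X1 X2] /andP[Y1 Y2].
  have := ler_wpM2l s0 X1; have := ler_wpM2l s0 X2.
  by have := ler_wpM2l s'0 Y1; have := ler_wpM2l s'0 Y2; lra.
- by rewrite addr_ge0// mulr_ge0.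
- have ge0 (x y z : R) : x ^+ 2 <= y <= z -> 0 <= y.
    by case/andP => + _; apply: le_trans; rewrite sqr_ge0.
  by apply: hyperbolic_convex => //;
    [exact: ge0 Xa|exact: ge0 Xb|exact: ge0 Ya|exact: ge0 Yb].
Qed.

Lemma convex_J_V : convex_set JV.
Proof.
move=> X Y l; rewrite !inE => /J_V_cuts[hX [X1 X2]] /J_V_cuts[hY [Y1 Y2]].
have [s [s01 lE]] := i01_complex l; have /andP[s0 s1] := s01.
have s'0 : 0 <= 1 - s by rewrite subr_ge0.
apply/J_V_cuts; split; first exact: hermsymmx_conv.
rewrite !(reW_conv _ _ _ _ _ _ lE) (imT_conv _ _ _ _ _ _ lE).
split.
- by have := ler_wpM2l s0 X1; have := ler_wpM2l s'0 Y1; lra.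
- by have := ler_wpM2l s0 X2; have := ler_wpM2l s'0 Y2; lra.
Qed.

Lemma sub_J_C_J_SV : JC `<=` JS `&` JV.
Proof.
move=> X [hX Xp]; split; first by split; rewrite ?Xp.
have [_ _ norm_le] := cone_functional L U.
case: hX => hX Xa Xb Xt Xw; apply/J_V_cuts; split=> //.
have a0 : 0 <= reW X 0 0.
  by case/andP: Xa => + _; apply: le_trans; rewrite sqr_ge0.
have b0 : 0 <= reW X 1 1.
  by case/andP: Xb => + _; apply: le_trans; rewrite sqr_ge0.
have ar := sqrt_between _ _ _ al0 be0 Xa; have bs := sqrt_between _ _ _ ga0 de0 Xb.
(* On J_C, sqrt a sqrt b = |z| <= g z, the inequality that [cuts_mul] asks for. *)
have := cuts_mul al be ga de _ _ _ al0 ga0 ar bs.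
rewrite !sqr_sqrtr//; apply; rewrite -sqrtrM// Xp; exact: norm_le.
Qed.

Lemma convex_hull_J_C : convex_hull JC = JS `&` JV.
Proof.
apply/seteqP; split.
  apply: smallest_sub; last exact: sub_J_C_J_SV.
  move=> X Y l; rewrite !inE => -[XS XV] [YS YV]; split; apply/set_mem.
    by apply: convex_J_S; rewrite inE.
  by apply: convex_J_V; rewrite inE.
(* For an arbitrary convex [A] containing [JC], [convex4_cone] applies to the coordinates of [X],
   with [P] the membership of [herm2] in [A]. *)
move=> X [[[hX Xa Xb Xt Xw] Xp] /J_V_cuts[_ Xcuts]] A [cA JCA].
have [pqL pqU norm_le] := cone_functional L U.
have kE (x : R) : Num.sqrt (1 + x ^+ 2) ^+ 2 = 1 + x ^+ 2.
  by rewrite sqr_sqrtr// addr_ge0 ?sqr_ge0.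
rewrite (hermsymmx_herm2 _ hX).
apply: (convex4_cone _ L U _ _ _ _ al be ga de (convex4_herm2 _ cA)
  (sqrt_sqr_add1_gt0 L) (sqrt_sqr_add1_gt0 U) (kE L) (kE U) LU pqL pqU norm_le)
  => // a b w t aP bP tP w0 abE.
apply: JCA; rewrite /JC /J_C /bounded_herm /=.
have [-> -> -> ->] := herm2_coord a b w t.
by split=> //; split=> //; exact: herm2_hermsymmx.
Qed.

End JSets.

Theorem proposition3 (R : realType) (Lii Uii Ljj Ujj Lij Uij : R)
    (hii0 : 0 <= Lii) (hii : Lii <= Uii)
    (hjj0 : 0 <= Ljj) (hjj : Ljj <= Ujj)
    (hij : Lij <= Uij) :
  convex_hull (J_C Lii Uii Ljj Ujj Lij Uij) =
  J_S Lii Uii Ljj Ujj Lij Uij `&` J_V Lii Uii Ljj Ujj Lij Uij.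
Proof.
rewrite -(sqr_sqrtr hii0) -(sqr_sqrtr (le_trans hii0 hii)).
rewrite -(sqr_sqrtr hjj0) -(sqr_sqrtr (le_trans hjj0 hjj)).
by apply: convex_hull_J_C; rewrite ?sqrtr_ge0 ?ler_wsqrtr.
Qed.
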